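(* Let $A_1\in\mathbb{R}_{+}^{m_1\times n_1}$ and $A_2\in\mathbb{R}_{+}^{m_2\times n_2}$. Suppose that, for each $i=1,2$, either $m_i\le 3$ or $n_i\le 3$. Then $$\operatorname{rk}_{+}(A_1\otimes A_2)=\operatorname{rk}_{+}(A_1)\operatorname{rk}_{+}(A_2).$$
   Context: Here $\mathbb{R}_{+}^{m\times n}$ is the set of $m\times n$ real matrices with nonnegative entries, and $\otimes$ is the Kronecker product. For $A\in\mathbb{R}_{+}^{m\times n}$, the nonnegative rank $\operatorname{rk}_{+}(A)$ is the smallest integer $k$ such that $A=UV^{T}$ for some $U\in\mathbb{R}_{+}^{m\times k}$ and $V\in\mathbb{R}_{+}^{n\times k}$, with the convention $\operatorname{rk}_{+}(0)=0$. *)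

(* Defs.v *)
From HB Require Import structures.
From mathcomp Require Import all_boot all_order all_algebra.
From mathcomp Require Import boolp reals.
From mathcomp.real_closed Require Export mxtens.

Set Implicit Arguments.
Unset Strict Implicit.
Unset Printing Implicit Defensive.

Import Order.TTheory GRing.Theory Num.Theory.
Local Open Scope ring_scope.

Definition nonneg_factorization (R : realType) m n (A : 'M[R]_(m, n)) (k : nat) :=
  exists U : 'M[R]_(m, k), exists V : 'M[R]_(n, k),
    [/\ U \is a mxOver Num.nneg, V \is a mxOver Num.nneg & A = U *m V^T].

(* The else branch is junk: it is only reached when A has a negative entry,
   by nonneg_factorization_full. *)
Definition nonneg_rank (R : realType) m n (A : 'M[R]_(m, n)) : nat :=
  if pselect (exists k, `[< nonneg_factorization A k >]) is left A_fact
  then ex_minn A_fact else 0%N.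

Lemma nonneg_factorization_full (R : realType) m n (A : 'M[R]_(m, n)) :
  A \is a mxOver Num.nneg -> nonneg_factorization A n.
Proof.
move=> A_ge0; exists A, 1%:M; split=> //; last by rewrite trmx1 mulmx1.
by apply/mxOverP=> i j; rewrite mxE nnegrE ler0n.
Qed.

Lemma nonneg_rankP (R : realType) m n (A : 'M[R]_(m, n)) :
  A \is a mxOver Num.nneg ->
  nonneg_factorization A (nonneg_rank A) /\
  (forall k, nonneg_factorization A k -> (nonneg_rank A <= k)%N).
Proof.
move=> A_ge0; rewrite /nonneg_rank; case: pselect => [A_fact | []].
  case: ex_minnP => k /asboolP Ak min_k; split=> // l Al.
  by apply: min_k; apply/asboolP.
by exists n; apply/asboolP; apply: nonneg_factorization_full.
Qed.

Lemma nonneg_rank0 (R : realType) m n : nonneg_rank (0 : 'M[R]_(m, n)) = 0%N.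
Proof.
have nn0 p q : (0 : 'M[R]_(p, q)) \is a mxOver Num.nneg.
  by apply/mxOverP=> i j; rewrite mxE nnegrE.
apply/eqP; rewrite -leqn0; apply: (nonneg_rankP (nn0 m n)).2.
by exists 0, 0; split=> //; rewrite mul0mx.
Qed.

(* Main.v *)
(** In dimension at most 3 the nonnegative rank equals the ordinary rank, which
    is multiplicative under Kronecker products. A matrix of rank 3 here has
    three rows or three columns, so one of the two trivial factorizations has
    size 3. For rank [r <= 2], add the rows one by one and keep a cone with [r]
    nonnegative generators in the row space containing them: a new row gives
    [r + 1 <= 3] linearly dependent nonnegative vectors, and up to sign a
    dependence among at most three vectors has at most one negative
    coefficient, so one of the vectors lies in the cone spanned by the others. *)
Require Import Defs.
From mathcomp Require Import all_boot all_order all_algebra.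
From mathcomp Require Import reals.

Set Implicit Arguments.
Unset Strict Implicit.
Unset Printing Implicit Defensive.

Import Order.TTheory GRing.Theory Num.Theory.
Local Open Scope ring_scope.

Lemma mxOver_nneg_mul (R : numDomainType) m n p
    (A : 'M[R]_(m, n)) (B : 'M[R]_(n, p)) :
  A \is a mxOver Num.nneg -> B \is a mxOver Num.nneg ->
  A *m B \is a mxOver Num.nneg.
Proof.
move=> /mxOverP A_ge0 /mxOverP B_ge0; apply/mxOverP => i j; rewrite mxE.
by apply: rpred_sum => k _; apply: rpredM.
Qed.

Lemma mxOver_nneg_tens (R : numDomainType) m n p q
    (A : 'M[R]_(m, n)) (B : 'M[R]_(p, q)) :
  A \is a mxOver Num.nneg -> B \is a mxOver Num.nneg ->
  A *t B \is a mxOver Num.nneg.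
Proof.
move=> /mxOverP A_ge0 /mxOverP B_ge0; apply/mxOverP => i j; rewrite mxE.
exact: rpredM.
Qed.

Lemma mxOver_nneg_col (R : numDomainType) m n p
    (A : 'M[R]_(m, p)) (B : 'M[R]_(n, p)) :
  A \is a mxOver Num.nneg -> B \is a mxOver Num.nneg ->
  col_mx A B \is a mxOver Num.nneg.
Proof.
move=> /mxOverP A_ge0 /mxOverP B_ge0; apply/mxOverP => i j; rewrite mxE.
by case: split.
Qed.

Lemma tensmx1 (R : pzRingType) m n :
  1%:M *t 1%:M = 1%:M :> 'M[R]_(m * n).
Proof.
apply/matrixP => i j.
case: (mxtens_indexP i) => i1 i2; case: (mxtens_indexP j) => j1 j2.
rewrite tensmxE !mxE (can_eq (@mxtens_indexK m n)) xpair_eqE.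
by rewrite -natrM mulnb.
Qed.

(** One-sided inverses of the row and column bases compress each factor to an identity matrix of
    size its rank. Tensoring these compressions turns [A *t B] into an identity of size
    [\rank A * \rank B], and multiplication cannot raise the rank. *)
Lemma leq_mxrank_tens (F : fieldType) m n p q
    (A : 'M[F]_(m, n)) (B : 'M[F]_(p, q)) :
  (\rank A * \rank B <= \rank (A *t B))%N.
Proof.
have compress k l (C : 'M[F]_(k, l)) :
  exists L : 'M_(\rank C, k), exists N : 'M_(l, \rank C), L *m C *m N = 1%:M.
  have /row_freeP[N rN] := row_base_free C.
  have /row_fullP[L cL] := col_base_full C.
  by exists L, N; rewrite -[X in L *m X](mulmx_base C) mulmxA cL mul1mx.
have [LA [NA eA]] := compress _ _ A; have [LB [NB eB]] := compress _ _ B.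
have := mxrankM_maxl ((LA *t LB) *m (A *t B)) (NA *t NB).
rewrite !tensmx_mul eA eB tensmx1 mxrank1 => /leq_trans -> //.
by rewrite -tensmx_mul mxrankM_maxr.
Qed.

Lemma card_neg_le1_up_to_sign (R : realDomainType) r (c : 'rV[R]_r.+1) :
  (r <= 2)%N -> c != 0 ->
  exists2 s : 'rV[R]_r.+1, s = c \/ s = - c &
    exists2 i, s 0 i != 0 & forall j, j != i -> 0 <= s 0 j.
Proof.
move=> r_le2 c_neq0; have [k ck] : exists k, c 0 k != 0.
  by apply/rV0Pn.
pose neg (s : 'rV[R]_r.+1) := [set i | s 0 i < 0].
suff [s sc s_le1] : exists2 s, s = c \/ s = - c & (#|neg s| <= 1)%N.
  exists s => //; have [/eqP neg0|[i neg_i]] := set_0Vmem (neg s).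
    (* With no negative entry, any nonzero position of [c] can serve as the exceptional index. *)
    exists k => [|j _]; first by case: sc => ->; rewrite ?mxE ?oppr_eq0.
    by move/eqP/setP/(_ j): neg0; rewrite !inE leNgt => ->.
  exists i => [|j j_neqi]; first by move: neg_i; rewrite inE => /lt_eqF ->.
  rewrite leNgt; apply: contra j_neqi => sj; apply/eqP.
  by apply: (card_le1_eqP s_le1) => //; rewrite inE.
have [c_le1|c_gt1] := leqP #|neg c| 1; first by exists c; first by left.
exists (- c); first by right.
have dis : [disjoint neg c & neg (- c)].
  rewrite -setI_eq0; apply/eqP/setP => i; rewrite !inE mxE oppr_lt0.
  by apply/negP => /andP[/lt_trans h /h]; rewrite ltxx.
have := max_card [in neg c :|: neg (- c)].
rewrite cardsU (disjoint_setI0 dis) cards0 subn0 card_ord => le_card.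
(* The negative positions of [c] and [- c] are disjoint, so two or more of each would need four
   indices, but there are only [r.+1 <= 3]. *)
rewrite -ltnS -(ltn_add2l 2) (leq_ltn_trans _ (_ : r.+1 < 4)%N) //.
by apply: leq_trans le_card; rewrite leq_add2r.
Qed.

Lemma dependent_nneg_row_in_cone (R : realFieldType) r n (M : 'M[R]_(r.+1, n)) :
  (r <= 2)%N -> M \is a mxOver Num.nneg -> (\rank M <= r)%N ->
  exists i, exists2 d : 'rV[R]_r, d \is a mxOver Num.nneg &
    row i M = d *m row' i M.
Proof.
move=> r_le2 /mxOverP M_ge0 rkM.
have : ~~ row_free M by rewrite -row_leq_rank -ltnNge ltnS.
rewrite -kermx_eq0 => /rowV0Pn[c /sub_kermxP cM c_neq0].
have [s sc [i si s_ge0]] := card_neg_le1_up_to_sign r_le2 c_neq0.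
have sM : s *m M = 0 by case: sc => ->; rewrite ?mulNmx cM ?oppr0.
have sumM j : s 0 i * M i j + \sum_k s 0 (lift i k) * M (lift i k) j = 0.
  by have /matrixP/(_ 0 j) := sM; rewrite !mxE (bigD1_ord i).
have sum_ge0 j : 0 <= \sum_k s 0 (lift i k) * M (lift i k) j.
  apply: sumr_ge0 => k _; apply: mulr_ge0; last exact: M_ge0.
  by apply: s_ge0; rewrite eq_sym neq_lift.
exists i; have [s_gt0|s_lt0|/eqP] := ltrgt0P (s 0 i); last by rewrite (negPf si).
  (* All coefficients of the dependence are nonnegative here, so each term of the vanishing sum is
     zero. As [s 0 i] is nonzero, row [i] is zero. *)
  exists 0; first by apply/mxOverP => a b; rewrite mxE nnegrE.
  rewrite mul0mx; apply/rowP => j; rewrite !mxE.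
  have /eqP := sumM j; rewrite paddr_eq0 //.
    by rewrite mulf_eq0 (negPf si) => /andP[/eqP].
  by apply: mulr_ge0 (ltW s_gt0) _; apply: M_ge0.
(* The only negative coefficient is at [i]: solving the dependence for row [i] gives nonnegative
   weights. *)
exists (\row_k (s 0 (lift i k) / - s 0 i)).
  apply/mxOverP => a k; rewrite mxE nnegrE divr_ge0 ?oppr_ge0 ?(ltW s_lt0) //.
  by rewrite s_ge0 // eq_sym neq_lift.
apply/rowP => j; rewrite !mxE.
under eq_bigr do rewrite !mxE mulrAC.
rewrite -mulr_suml; apply: (canRL (mulfK _)); first by rewrite oppr_eq0.
by rewrite mulrN mulrC; apply/eqP; rewrite eq_sym -addr_eq0 addrC sumM.
Qed.

Lemma dependent_nneg_drop_row (R : realFieldType) r n (M : 'M[R]_(r.+1, n)) :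
  (r <= 2)%N -> M \is a mxOver Num.nneg -> (\rank M <= r)%N ->
  exists i, exists2 D : 'M[R]_(r.+1, r), D \is a mxOver Num.nneg &
    M = D *m row' i M.
Proof.
move=> r_le2 M_ge0 rkM.
have [i [d /mxOverP d_ge0 eM]] := dependent_nneg_row_in_cone r_le2 M_ge0 rkM.
(* [D] is the identity matrix with [d] inserted as row [i]. *)
exists i; exists (\matrix_(j, k) if unlift i j is Some j' then (j' == k)%:R else d 0 k).
  apply/mxOverP => j k; rewrite mxE; case: unliftP => [j' _|_] //.
  by rewrite nnegrE ler0n.
apply/row_matrixP => j; rewrite row_mul.
have [j' ->|->] := unliftP i j; last first.
  by rewrite eM; congr (_ *m _); apply/rowP => k; rewrite !mxE unlift_none.
have -> : row (lift i j') M = row j' (row' i M) by apply/rowP => k; rewrite !mxE.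
rewrite [LHS]rowE; congr (_ *m _); apply/rowP => k.
by rewrite !mxE liftK eqxx eq_sym.
Qed.

Lemma nneg_rows_in_cone (R : realFieldType) r p n (S : 'M[R]_(p, n)) m
    (A : 'M[R]_(m, n)) :
  (r <= 2)%N -> (\rank S <= r)%N -> A \is a mxOver Num.nneg -> (A <= S)%MS ->
  exists U : 'M[R]_(m, r), exists V : 'M[R]_(r, n),
    [/\ U \is a mxOver Num.nneg, V \is a mxOver Num.nneg, (V <= S)%MS
      & A = U *m V].
Proof.
move=> r_le2 rkS; elim: m A => [|m IHm] A A_ge0 A_S.
  exists 0, 0; split; rewrite ?sub0mx //; try by apply/mxOverP => i j; rewrite mxE nnegrE.
  by rewrite mul0mx; apply: flatmx0.
move: A A_ge0 A_S; rewrite -[m.+1]/(1 + m)%N => A /mxOverP A_ge0 A_S.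
have a_ge0 : usubmx A \is a mxOver Num.nneg by apply/mxOverP => i j; rewrite mxE.
have A'_ge0 : dsubmx A \is a mxOver Num.nneg by apply/mxOverP => i j; rewrite mxE.
move: A_S; rewrite -[A in (A <= _)%MS]vsubmxK col_mx_sub => /andP[a_S A'_S].
have [U [V [U_ge0 V_ge0 V_S eA']]] := IHm _ A'_ge0 A'_S.
pose M : 'M_(1 + r, n) := col_mx (usubmx A) V.
have M_ge0 : M \is a mxOver Num.nneg by apply: mxOver_nneg_col.
have M_S : (M <= S)%MS by rewrite col_mx_sub a_S.
have rkM : (\rank M <= r)%N := leq_trans (mxrankS M_S) rkS.
have [i [D D_ge0 eM]] := dependent_nneg_drop_row r_le2 M_ge0 rkM.
(* [P] writes [A] over the enlarged generators [M]: the new row is its own generator, and the old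
   rows keep their coefficients [U]. Then [A = P *m M], and [D] rewrites [M] over the surviving
   generators. *)
pose P : 'M_(1 + m, r.+1) := block_mx (1%:M : 'M_1) 0 0 U.
exists (P *m D), (row' i M); split.
- apply: mxOver_nneg_mul D_ge0; apply/mxOverP => j k; rewrite !mxE.
  case: split => j'; rewrite mxE; case: split => k'; rewrite ?mxE ?nnegrE //.
  exact: (mxOverP U_ge0).
- by apply/mxOverP => j k; rewrite mxE; apply: (mxOverP M_ge0).
- apply: submx_trans M_S; apply/row_subP => j.
  have -> : row j (row' i M) = row (lift i j) M by apply/rowP => k; rewrite !mxE.
  exact: row_sub.
- rewrite -mulmxA -eM; have -> := mul_block_col 1%:M 0 0 U (usubmx A) V.
  by rewrite mul1mx !mul0mx addr0 add0r -eA' vsubmxK.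
Qed.

Lemma nonneg_factorization_tr (R : realType) m n (A : 'M[R]_(m, n)) k :
  nonneg_factorization A k -> nonneg_factorization A^T k.
Proof.
by move=> [U [V [U_ge0 V_ge0 ->]]]; exists V, U; rewrite trmx_mul trmxK.
Qed.

Lemma nonneg_factorization_tens (R : realType) m n p q
    (A : 'M[R]_(m, n)) (B : 'M[R]_(p, q)) k l :
  nonneg_factorization A k -> nonneg_factorization B l ->
  nonneg_factorization (A *t B) (k * l).
Proof.
move=> [U [V [U_ge0 V_ge0 ->]]] [X [Y [X_ge0 Y_ge0 ->]]].
exists (U *t X), (V *t Y).
by split; rewrite ?mxOver_nneg_tens // trmx_tens tensmx_mul.
Qed.

Lemma mxrank_le_nonneg_factorization (R : realType) m n (A : 'M[R]_(m, n)) k :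
  nonneg_factorization A k -> (\rank A <= k)%N.
Proof.
by move=> [U [V [_ _ ->]]]; apply: leq_trans (mxrankM_maxl _ _) (rank_leq_col _).
Qed.

Lemma nonneg_factorization_mxrank (R : realType) m n (A : 'M[R]_(m, n)) :
  A \is a mxOver Num.nneg -> (m <= 3)%N \/ (n <= 3)%N ->
  nonneg_factorization A (\rank A).
Proof.
move=> A_ge0 dimA; have [rk_le2|rk_gt2] := leqP (\rank A) 2.
  have [U [V [U_ge0 V_ge0 _ eA]]] :=
    nneg_rows_in_cone rk_le2 (leqnn _) A_ge0 (submx_refl A).
  by exists U, V^T; rewrite trmxK; split=> //; apply/mxOverP => i j;
     rewrite mxE; apply: (mxOverP V_ge0).
(* A rank of at least 3 with a dimension of at most 3 forces the rank to equal that dimension. *)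
case: dimA => dimA.
  have -> : \rank A = m.
    by apply/eqP; rewrite eqn_leq rank_leq_row (leq_trans dimA).
  rewrite -[A]trmxK; apply/nonneg_factorization_tr/nonneg_factorization_full.
  by apply/mxOverP => i j; rewrite mxE; apply: (mxOverP A_ge0).
have -> : \rank A = n.
  by apply/eqP; rewrite eqn_leq rank_leq_col (leq_trans dimA).
exact: nonneg_factorization_full.
Qed.

Lemma nonneg_rank_eq_mxrank (R : realType) m n (A : 'M[R]_(m, n)) :
  A \is a mxOver Num.nneg -> (m <= 3)%N \/ (n <= 3)%N ->
  nonneg_rank A = \rank A.
Proof.
move=> A_ge0 dimA; have [factA minA] := nonneg_rankP A_ge0.
apply/eqP; rewrite eqn_leq (mxrank_le_nonneg_factorization factA) andbT.
exact/minA/nonneg_factorization_mxrank.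
Qed.

Theorem theorem1p4 (R : realType) (m1 n1 m2 n2 : nat)
    (A1 : 'M[R]_(m1, n1)) (A2 : 'M[R]_(m2, n2))
    (A1_ge0 : A1 \is a mxOver Num.nneg) (A2_ge0 : A2 \is a mxOver Num.nneg)
    (dim1 : (m1 <= 3)%N \/ (n1 <= 3)%N) (dim2 : (m2 <= 3)%N \/ (n2 <= 3)%N) :
  nonneg_rank (A1 *t A2) = (nonneg_rank A1 * nonneg_rank A2)%N.
Proof.
have [fact12 min12] := nonneg_rankP (mxOver_nneg_tens A1_ge0 A2_ge0).
apply/eqP; rewrite eqn_leq; apply/andP; split.
  apply/min12/nonneg_factorization_tens.
    exact: (nonneg_rankP A1_ge0).1.
  exact: (nonneg_rankP A2_ge0).1.
(* Both dimensions of the product may exceed 3, so only the factors are replaced by their ranks. For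
   the product, the general bound of the rank by the size of a nonnegative factorization
   suffices. *)
rewrite (nonneg_rank_eq_mxrank A1_ge0) // (nonneg_rank_eq_mxrank A2_ge0) //.
apply: leq_trans (leq_mxrank_tens A1 A2) _.
exact: mxrank_le_nonneg_factorization.
Qed.
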